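(* Let $0<\epsilon<\frac{1}{50}$ and let $V,E,D$ be positive integers. Suppose that $E\ge V^{2+\epsilon}$ and $E\ge e^{2D/\epsilon^2}$. Then $$P(V,E,D)\ge 1-\frac{1}{E^{\epsilon/8}}.$$
   Context: A graph $\Gamma$ consists of a vertex set $V(\Gamma)$, a set $E(\Gamma)$ of (oriented) edges, a reverse map $e\mapsto\overline{e}$ on $E(\Gamma)$ with $\overline{e}\neq e$ and $\overline{\overline{e}}=e$, and an initial vertex map $\iota:E(\Gamma)\to V(\Gamma)$; the terminal vertex is $\tau(e)=\iota(\overline{e})$. A topological edge is a pair $\{e,\overline e\}$. Loops and multiple edges are allowed. A GBS graph is a pair $(\Gamma,\psi)$ with $\Gamma$ a finite graph and $\psi:E(\Gamma)\to\mathbb{Z}\setminus\{0\}$; $\psi(e)$ is the label on $e$ near $\tau(e)$. When $\Gamma$ is connected, the GBS group represented by $(\Gamma,\psi)$ is defined as follows. Choose a maximal tree $T=\overline{T}\subseteq E(\Gamma)$. The generators are $a_v$ for $v\in V(\Gamma)$ and $t_e$ for $e\in E(\Gamma)\setminus T$. The relations are: $a_{\iota(e)}^{\psi(\overline e)}=a_{\tau(e)}^{\psi(e)}$ for $e\in T$; and $t_{\overline e}=t_e^{-1}$ and $a_{\iota(e)}^{\psi(\overline e)}t_e=t_e a_{\tau(e)}^{\psi(e)}$ for $e\in E(\Gamma)\setminus T$. The isomorphism type does not depend on $T$. No GBS group is defined when $\Gamma$ is disconnected. Fully reduced: a connected $(\Gamma,\psi)$ is fully reduced if there are no distinct vertices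 $v,u$ such that, in its GBS group, $a_v$ is conjugate to a power of $a_u$ (this does not depend on $T$). Set of primes: $\mathcal{P}(\Gamma,\psi)$ is the set of primes $r$ with $r\mid\psi(e)$ for some $e\in E(\Gamma)$. Minimal edge: $e\in E(\Gamma)$ is minimal if there is no $e'\in E(\Gamma)$ with $\tau(e')=\tau(e)$, $\psi(e')\mid\psi(e)$ and $\psi(e')\neq\pm\psi(e)$. Flexible: $(\Gamma,\psi)$ is flexible if it is connected and (1) it is fully reduced; (2) there is no $e\in E(\Gamma)$ such that both $e$ and $\overline e$ are minimal; (3) for every two distinct edges $e,e'\in E(\Gamma)$ with $\tau(e)=\tau(e')$, if $\psi(e)\mid\psi(e')$ then $\psi(e')/\psi(e)$ is a multiple of every prime in $\mathcal{P}(\Gamma,\psi)$. Random GBS graph with parameters $V,E,D,N$ (positive integers): fix a set $\{p_1,\dots,p_D\}$ of $D$ distinct primes (which one is irrelevant for flexibility). The vertex set is $[V]=\{1,\dots,V\}$. Let $v_1,\dots,v_{2E}$ be independent and uniform in $[V]$; the $E$ topological edges join $v_{2i-1}$ to $v_{2i}$, $i=1,\dots,E$ (a loop if these coincide). Independently of the graph, each of the $2E$ oriented edges $e_i$ receives the label $\psi(e_i)=(-1)^{\epsilon_i}\prod_{j=1}^D p_j^{\alpha_{i,j}}$, where all $\epsilon_i$ and $\alpha_{i,j}$ are independent, $\epsilon_i$ is uniform in $\{0,1\}$ and $\alpha_{i,j}$ is uniform in $\{0,1,\dots,N-1\}$. Let $p(V,E,D,N)\in[0,1]$ be the probability that a random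 GBS graph with parameters $V,E,D,N$ is flexible, and define $P(V,E,D):=\liminf_{N\to+\infty}p(V,E,D,N)$. *)

(* Defs.v *)
From HB Require Import structures.
From mathcomp Require Import all_boot all_order all_algebra.
From mathcomp Require Import all_classical all_reals all_analysis.

Set Implicit Arguments.
Unset Strict Implicit.
Unset Printing Implicit Defensive.

Import Order.TTheory GRing.Theory Num.Theory.

(* The letter (x, false) stands for the generator x, (x, true) for x^-1.      *)
Definition word (A : choiceType) := seq (A * bool).

Definition inv_letter (A : choiceType) (l : A * bool) : A * bool :=
  (l.1, ~~ l.2).

Definition inv_word (A : choiceType) (w : word A) : word A :=
  rev (map (@inv_letter A) w).

Definition pow_word (A : choiceType) (x : A) (n : int) : word A :=
  nseq (absz n) (x, (n < 0)%R).

Inductive word_eq (A : choiceType) (rels : word A -> word A -> Prop) :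
    word A -> word A -> Prop :=
  | WordRefl w : word_eq rels w w
  | WordSym w1 w2 : word_eq rels w1 w2 -> word_eq rels w2 w1
  | WordTrans w1 w2 w3 :
      word_eq rels w1 w2 -> word_eq rels w2 w3 -> word_eq rels w1 w3
  | WordCat w1 w2 w3 w4 : word_eq rels w1 w2 -> word_eq rels w3 w4 ->
      word_eq rels (w1 ++ w3) (w2 ++ w4)
  | WordCancel l : word_eq rels [:: l; inv_letter l] [::]
  | WordRel w1 w2 : rels w1 w2 -> word_eq rels w1 w2.

Section PresentedGroup.
Variables (A : choiceType) (rels : word A -> word A -> Prop).

Definition word_eqb : rel (word A) := fun w1 w2 => `[< word_eq rels w1 w2 >].

Lemma word_eqb_equiv : equiv_class_of word_eqb.
Proof.
split=> [w | w1 w2 | w2 w1 w3].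
- exact/asboolP/WordRefl.
- by apply/asboolP/asboolP; apply: WordSym.
- by move=> /asboolP h12 /asboolP h23; apply/asboolP; apply: WordTrans h23.
Qed.

Canonical word_eqb_equivRel := EquivRelPack word_eqb_equiv.

Definition presented_group := {eq_quot word_eqb}%qT.

HB.instance Definition _ := Choice.on presented_group.

Definition word_class (w : word A) : presented_group := (\pi w)%qT.

Lemma word_classP w1 w2 :
  word_class w1 = word_class w2 <-> word_eq rels w1 w2.
Proof.
by split=> [/eqmodP h | h]; [exact/asboolP | apply/eqmodP; exact/asboolP].
Qed.

Definition pg_one := word_class [::].
Definition pg_mul (x y : presented_group) := word_class (repr x ++ repr y).
Definition pg_inv (x : presented_group) := word_class (inv_word (repr x)).

Lemma word_class_repr x : word_class (repr x) = x.
Proof. exact: reprK. Qed.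

Lemma repr_word_class w : word_eq rels (repr (word_class w)) w.
Proof. by apply/word_classP; rewrite word_class_repr. Qed.

Lemma pg_mulE w1 w2 :
  pg_mul (word_class w1) (word_class w2) = word_class (w1 ++ w2).
Proof. by apply/word_classP/WordCat; apply: repr_word_class. Qed.

Lemma word_eq_mulV w : word_eq rels (w ++ inv_word w) [::].
Proof.
elim: w => [|l w IHw]; first exact: WordRefl.
rewrite /inv_word /= rev_cons -cats1 -/(inv_word w).
apply: WordTrans (WordCancel rels l).
apply: (@WordCat _ _ [:: l] [:: l]); first exact: WordRefl.
rewrite catA; apply: (@WordCat _ _ _ [::]); first exact: IHw.
exact: WordRefl.
Qed.

Lemma inv_wordK : involutive (@inv_word A).
Proof.
move=> w; rewrite /inv_word map_rev revK -map_comp map_id_in // => -[x b] _ /=.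
by rewrite /inv_letter /= negbK.
Qed.

Lemma word_eq_mulVl w : word_eq rels (inv_word w ++ w) [::].
Proof. by have := word_eq_mulV (inv_word w); rewrite inv_wordK. Qed.

Lemma pg_mulA : associative pg_mul.
Proof.
move=> x y z; rewrite -(word_class_repr x) -(word_class_repr y).
by rewrite -(word_class_repr z) !pg_mulE catA.
Qed.

Lemma pg_mul1g : left_id pg_one pg_mul.
Proof. by move=> x; rewrite -{1}(word_class_repr x) pg_mulE word_class_repr. Qed.

Lemma pg_mulg1 : right_id pg_one pg_mul.
Proof.
by move=> x; rewrite -{1}(word_class_repr x) pg_mulE cats0 word_class_repr.
Qed.

Lemma pg_mulVg : left_inverse pg_one pg_inv pg_mul.
Proof.
move=> x; rewrite -{2}(word_class_repr x) pg_mulE.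
exact/word_classP/word_eq_mulVl.
Qed.

Lemma pg_mulgV : right_inverse pg_one pg_inv pg_mul.
Proof.
move=> x; rewrite -{1}(word_class_repr x) pg_mulE.
exact/word_classP/word_eq_mulV.
Qed.

HB.instance Definition _ := isGroup.Build presented_group
  pg_mulA pg_mul1g pg_mulg1 pg_mulVg pg_mulgV.

End PresentedGroup.

Definition zexpg (G : groupType) (x : G) (n : int) : G :=
  match n with Posz k => (x ^+ k)%g | Negz k => (x ^- k.+1)%g end.

Local Open Scope ring_scope.

Record graph := Graph {
  vertex : finType;
  edge : finType;
  erev : edge -> edge;
  source : edge -> vertex;
  erevK : involutive erev;
  erev_neq : forall e, erev e != e }.

Definition target (G : graph) (e : edge G) : vertex G := source (erev e).

Record gbs_graph := GBSGraph {
  gbs_base :> graph;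
  label : edge gbs_base -> int;
  label_neq0 : forall e, label e != 0 }.

Definition edge_adj (G : graph) (T : {set edge G}) : rel (vertex G) :=
  fun u v => [exists e in T, (source e == u) && (target e == v)].

Definition connected_graph (G : graph) : Prop :=
  forall u v : vertex G, connect (edge_adj [set: edge G]%SET) u v.

(* A subtree is encoded by its set of edges, its vertices being their         *)
(* endpoints (a single vertex has no edges).  [cycle] also relates the last   *)
(* edge of p to the first one, so p below is a cyclically reduced circuit.    *)
Definition subtree (G : graph) (T : {set edge G}) : Prop :=
  [/\ {in T, forall e, erev e \in T},
      {in T &, forall e f, connect (edge_adj T) (source e) (source f)}
    & forall p : seq (edge G), {subset p <= T} ->
        cycle (fun e f => (target e == source f) && (f != erev e)) p ->
        p = [::]].

Definition maximal_tree (G : graph) (T : {set edge G}) : Prop :=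
  subtree T /\ forall T' : {set edge G}, subtree T' -> T \subset T' -> T' = T.

(* The generator a_v is inl v, the stable letter t_e is inr e.                *)
Definition gbs_gen (G : graph) (T : {set edge G}) : choiceType :=
  (vertex G + {e : edge G | e \notin T})%type.

Definition gbs_a (G : graph) (T : {set edge G}) (v : vertex G) : gbs_gen T :=
  inl v.

Definition gbs_t (G : graph) (T : {set edge G})
  (e : {e : edge G | e \notin T}) : gbs_gen T := inr e.

Inductive gbs_rel (G : gbs_graph) (T : {set edge G}) :
    word (gbs_gen T) -> word (gbs_gen T) -> Prop :=
  | GBSTree e : e \in T ->
      gbs_rel (pow_word (gbs_a T (source e)) (label (erev e)))
              (pow_word (gbs_a T (target e)) (label e))
  | GBSInv e f : val f = erev (val e) ->
      gbs_rel (pow_word (gbs_t f) 1) (pow_word (gbs_t e) (-1))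
  | GBSStable e :
      gbs_rel (pow_word (gbs_a T (source (val e))) (label (erev (val e)))
                 ++ pow_word (gbs_t e) 1)
              (pow_word (gbs_t e) 1
                 ++ pow_word (gbs_a T (target (val e))) (label (val e))).

Definition gbs_group (G : gbs_graph) (T : {set edge G}) : groupType :=
  presented_group (@gbs_rel G T).

Definition vertex_elt (G : gbs_graph) (T : {set edge G}) (v : vertex G) :
    gbs_group T :=
  word_class (@gbs_rel G T) (pow_word (gbs_a T v) 1).

Definition conj_to_power (H : groupType) (x y : H) : Prop :=
  exists (g : H) (n : int), (x ^ g)%g = zexpg y n.

(* The defining property does not depend on the maximal tree T.               *)
Definition fully_reduced (G : gbs_graph) : Prop :=
  connected_graph G /\
  exists2 T : {set edge G}, maximal_tree T &
    ~ exists v u : vertex G,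
        v != u /\ conj_to_power (vertex_elt T v) (vertex_elt T u).

Definition prime_set (G : gbs_graph) (r : nat) : Prop :=
  prime r /\ exists e : edge G, (r %| label e)%Z.

Definition minimal_edge (G : gbs_graph) (e : edge G) : Prop :=
  ~ exists e' : edge G,
      [/\ target e' = target e, (label e' %| label e)%Z,
          label e' != label e & label e' != - label e].

Definition flexible (G : gbs_graph) : Prop :=
  [/\ connected_graph G,
      fully_reduced G,
      ~ exists e : edge G, minimal_edge e /\ minimal_edge (erev e)
    & forall e e' : edge G, e != e' -> target e = target e' ->
        (label e %| label e')%Z ->
        forall r : nat, prime_set G r -> (r %| label e' %/ label e)%Z].

(* The i-th topological edge has the orientations (i, false) and (i, true).   *)
Definition oedge (E : nat) : finType := ('I_E * bool)%type.

Definition oedge_rev (E : nat) (e : oedge E) : oedge E := (e.1, ~~ e.2).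

Lemma oedge_revK (E : nat) : involutive (@oedge_rev E).
Proof. by case=> i b; rewrite /oedge_rev /= negbK. Qed.

Lemma oedge_rev_neq (E : nat) (e : oedge E) : oedge_rev e != e.
Proof. by case: e => i b; rewrite xpair_eqE eqxx /=; case: b. Qed.

(* Initial vertices of the oriented edges, signs and exponents of the labels. *)
Definition outcome (V E D N : nat) : finType :=
  ({ffun oedge E -> 'I_V} * {ffun oedge E -> bool}
     * {ffun oedge E * 'I_D -> 'I_N})%type.

Definition random_graph (V E D N : nat) (w : outcome V E D N) : graph :=
  @Graph 'I_V (oedge E) (@oedge_rev E) (fun e => w.1.1 e)
    (@oedge_revK E) (@oedge_rev_neq E).

Definition random_label (V E D N : nat) (p : 'I_D -> nat)
    (w : outcome V E D N) (e : oedge E) : int :=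
  (-1) ^+ w.1.2 e * \prod_(j < D) (p j)%:Z ^+ w.2 (e, j).

Lemma random_label_neq0 (V E D N : nat) (p : 'I_D -> nat)
    (p_prime : forall j, prime (p j)) (w : outcome V E D N) (e : oedge E) :
  random_label p w e != 0.
Proof.
rewrite mulf_neq0 ?signr_eq0 //; apply/prodf_neq0 => j _.
by rewrite expf_neq0 // -lt0n prime_gt0.
Qed.

Definition random_gbs (V E D N : nat) (p : 'I_D -> nat)
    (p_prime : forall j, prime (p j)) (w : outcome V E D N) : gbs_graph :=
  @GBSGraph (random_graph w) (random_label p w) (random_label_neq0 p_prime w).

(* Independent uniform choices amount to a uniform choice of the outcome.     *)
Definition flexible_prob (R : realType) (V E D N : nat) (p : 'I_D -> nat)
    (p_prime : forall j, prime (p j)) : R :=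
  #|[pred w : outcome V E D N | `[< flexible (random_gbs p_prime w) >]]|%:R
    / #|{: outcome V E D N}|%:R.

Definition flexible_liminf (R : realType) (V E D : nat) (p : 'I_D -> nat)
    (p_prime : forall j, prime (p j)) : R :=
  limn_inf (fun N => flexible_prob R V E N p_prime).

(* Main.v *)
Require Import Defs.
From mathcomp Require Import all_boot all_order all_algebra.
From mathcomp Require Import all_classical all_reals all_analysis.
From mathcomp Require Import zify ring lra.

(* With probability tending to 1 as N grows, all exponents are positive and,
   for each prime p_j, pairwise distinct.  If they are positive then p_j divides
   every label, so for each vertex v the group maps to Z/p_j by a_v |-> 1, all
   other generators going to 0; hence a_v is not conjugate to a power of another
   a_u.  If they are distinct then divisibility of labels forces strict
   inequalities of exponents, whence condition (3).

   An edge with exponents a is minimal when none of the other edges ending at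
   the same vertex lies below it, which has conditional probability at most
   exp(- m vol(a)), where vol(a) = prod_j (a_j + 1) / N and m is of order E / V.
   Since exp(-y) <= y^(-s) and the mean of vol^(-s) is at most (1 - s)^(-D), a
   topological edge is minimal at both ends with probability at most
   (m^(-s) (1 - s)^(-D))^2.  The choice s = 1 - eps / 20 makes the sum over the
   E edges small.  Finally E >= V^(2 + eps) is so large that every two vertices
   are joined by an edge, except with probability V^2 exp(- E / V^2). *)

Set Implicit Arguments.
Unset Strict Implicit.
Unset Printing Implicit Defensive.

Import Order.TTheory GRing.Theory Num.Theory.
Local Open Scope ring_scope.

(** * Deterministic conditions for flexibility *)

Section PresentedGroupCharacter.
Variables (A : choiceType) (rels : word A -> word A -> Prop).
Variables (M : zmodType) (f : A -> M).

(** The homomorphism from the free group on [A] to [M] that extends [f], written on words. *)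
Definition word_val (w : word A) : M :=
  \sum_(l <- w) (if l.2 then - f l.1 else f l.1).

Lemma word_val_cat w1 w2 : word_val (w1 ++ w2) = word_val w1 + word_val w2.
Proof. by rewrite /word_val big_cat. Qed.

Lemma word_val_pow x n : word_val (pow_word x n) = f x *~ n.
Proof.
rewrite /word_val /pow_word.
rewrite big_nseq_cond /= iter_addr_0.
by case: n => n //=; rewrite NegzE mulNrn mulrNz.
Qed.

Hypothesis f_rels : forall w1 w2, rels w1 w2 -> word_val w1 = word_val w2.

Lemma word_eq_val w1 w2 : word_eq rels w1 w2 -> word_val w1 = word_val w2.
Proof.
elim=> {w1 w2} [//|//|w1 w2 w3 _ -> _ ->//|w1 w2 w3 w4 _ e1 _ e2|[x b]|//].
- by rewrite !word_val_cat e1 e2.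
- rewrite /word_val !big_cons big_nil addr0.
  by case: b => /=; rewrite ?subrr ?addNr.
Qed.

Definition pg_val (x : presented_group rels) : M := word_val (repr x).

Lemma pg_val_class w : pg_val (word_class rels w) = word_val w.
Proof. exact/word_eq_val/repr_word_class. Qed.

Lemma pg_valM x y : pg_val (x * y)%g = pg_val x + pg_val y.
Proof. by rewrite [LHS]pg_val_class word_val_cat. Qed.

Lemma pg_val1 : pg_val 1%g = 0.
Proof. by rewrite [LHS]pg_val_class /word_val big_nil. Qed.

Lemma pg_valV x : pg_val (x^-1)%g = - pg_val x.
Proof. by apply/(addrI (pg_val x)); rewrite -pg_valM mulgV pg_val1 subrr. Qed.

Lemma pg_valX x n : pg_val (x ^+ n)%g = pg_val x *+ n.
Proof.
elim: n => [|n IHn]; first by rewrite expg0 pg_val1.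
by rewrite expgS pg_valM IHn mulrS.
Qed.

(** As [M] is abelian, conjugation does not change the value, so a character can obstruct
    [conj_to_power]. *)
Lemma pg_val_conj_to_power x y : conj_to_power x y ->
  exists n : int, pg_val x = pg_val y *~ n.
Proof.
case=> g [n xgE]; exists n.
have <- : pg_val (x ^ g)%g = pg_val x.
  by rewrite conjgE !pg_valM pg_valV addrCA addNr addr0.
rewrite xgE; case: n {xgE} => n /=; first by rewrite pg_valX.
by rewrite pg_valV pg_valX NegzE mulrNz.
Qed.

End PresentedGroupCharacter.

(** The empty edge set is a subtree and there are finitely many edge sets, so some subtree is
    maximal for inclusion. *)
Lemma exists_maximal_tree (G : graph) : exists T : {set edge G}, maximal_tree T.
Proof.
have subtree0 : `[< subtree (finset.set0 : {set edge G}) >].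
  apply/asboolP; split=> [e|e|[//|e p] p0 _]; rewrite ?inE //.
  by have := p0 e; rewrite !inE eqxx => /(_ isT).
have [|T] := @ex_maxset _ (fun T : {set edge G} => `[< subtree T >]).
  exists finset.set0. exact: subtree0.
move=> /maxsetP[/asboolP treeT maxT]; exists T; split=> // T' treeT' TT'.
by apply: maxT => //; apply/asboolP.
Qed.

(* The character of the GBS group to Z/q that sends a_v to 1 and all other
   generators to 0 kills a_u but not a_v. *)
Lemma fully_reduced_prime_dvd_labels (G : gbs_graph) (q : nat) :
  connected_graph G -> prime q -> (forall e : edge G, (q %| label e)%Z) ->
  fully_reduced G.
Proof.
move=> Gconn q_prime q_label; split=> //.
have [T maxT] := exists_maximal_tree G; exists T => // -[v [u [vu]]].
pose f (x : gbs_gen T) : 'F_q := if x is inl z then (z == v)%:R else 0.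
have labelF (e : edge G) : ((label e)%:~R : 'F_q) = 0.
  by apply/eqP; rewrite -(dvdz_pcharf (pchar_Fp q_prime)) q_label.
have f_rels w1 w2 : @gbs_rel G T w1 w2 -> word_val f w1 = word_val f w2.
  have valE (e : edge G) x : word_val f (pow_word x (label e)) = 0.
    by rewrite word_val_pow -mulrzr labelF mulr0.
  case=> [e _|e e' _|e]; rewrite ?word_val_cat ?valE //.
  - by rewrite !word_val_pow /= !mul0rz.
  - by rewrite addrC.
move=> /(pg_val_conj_to_power f_rels)[n].
rewrite !pg_val_class // !word_val_pow /= eqxx eq_sym (negPf vu) !mul0rz mulr1z.
by move/eqP; rewrite oner_eq0.
Qed.

(** * Divisibility of labels in terms of exponents, and a criterion for flexibility *)

Section DivisibilityOfLabels.
Variables (V E D N : nat) (p : 'I_D -> nat).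
Hypotheses (p_prime : forall j, prime (p j)) (p_inj : injective p).
Implicit Types (w : outcome V E D N) (e f : oedge E).

Lemma absz_random_label w e :
  `|random_label p w e|%N = (\prod_(j < D) p j ^ w.2 (e, j))%N.
Proof.
rewrite /random_label abszMsign.
elim/big_rec2: _ => //= j m n _ <-.
by rewrite abszM abszX.
Qed.

(** The primes are distinct, so the cofactor of [p j ^ w.2 (e, j)] is coprime to [p j]. *)
Lemma logn_random_label w e j : logn (p j) `|random_label p w e| = w.2 (e, j).
Proof.
have p_gt0 k : (0 < p k ^ w.2 (e, k))%N by rewrite expn_gt0 prime_gt0.
rewrite absz_random_label (bigD1 j) //= lognM ?prodn_gt0 //.
rewrite pfactorK // logn_coprime ?addn0 //.
elim/big_ind: _ => [|m n|k kj]; first exact: coprimen1.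
  by rewrite coprimeMr => -> ->.
by rewrite coprimeXr // prime_coprime // dvdn_prime2 // (inj_eq p_inj) eq_sym.
Qed.

Lemma dvd_random_label_exp w e f :
  (random_label p w e %| random_label p w f)%Z ->
  forall j, (w.2 (e, j) <= w.2 (f, j))%N.
Proof.
move=> ef j; rewrite -!logn_random_label; apply: dvdn_leq_log => //.
by rewrite absz_gt0 random_label_neq0.
Qed.

Lemma dvd_random_label w e f : (forall j, (w.2 (e, j) <= w.2 (f, j))%N) ->
  (random_label p w e %| random_label p w f)%Z.
Proof.
move=> ef; rewrite dvdzE !absz_random_label.
by elim/big_rec2: _ => // j m n _ mn; rewrite dvdn_mul ?dvdn_exp2l.
Qed.

(** The extra factor [p k] is absorbed by the strict inequality at [k]; this serves condition
    (3). *)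
Lemma mul_dvd_random_label w e f k :
  (forall j, (w.2 (e, j) < w.2 (f, j))%N) ->
  ((p k)%:Z * random_label p w e %| random_label p w f)%Z.
Proof.
move=> ef; rewrite dvdzE abszM !absz_random_label.
rewrite (bigD1 k) //= [X in (_ %| X)%N](bigD1 k) //= mulnA -expnS.
apply: dvdn_mul; first by rewrite dvdn_exp2l.
by elim/big_rec2: _ => // j m n _ mn; rewrite dvdn_mul ?dvdn_exp2l // ltnW.
Qed.

Lemma prime_set_random_gbs w r : prime_set (random_gbs p_prime w) r ->
  exists j, r = p j.
Proof.
case=> r_prime [e]; rewrite dvdzE absz_random_label Euclid_dvd_prod //.
rewrite big_has => /hasP[j _]; rewrite Euclid_dvdX // => /andP[+ _].
by rewrite dvdn_prime2 // => /eqP; exists j.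
Qed.

(** The source of a reversed edge is the target of the edge; comparing exponents expresses
    divisibility of labels. *)
Definition edge_below w (f e : oedge E) : bool :=
  (w.1.1 (oedge_rev f) == w.1.1 (oedge_rev e)) &&
  [forall j, (w.2 (f, j) <= w.2 (e, j))%N].

(** Both orientations of [i] are left out as competitors, so that the remaining ones are independent
    of the data of [i]. *)
Definition no_edge_below w (i : 'I_E) : bool :=
  [forall (f | (f != (i, false)) && (f != (i, true))),
     ~~ edge_below w f (i, false) && ~~ edge_below w f (i, true)].

(** Fixing the orientation makes this a condition of probability [1 / V ^ 2] on each topological
    edge. *)
Definition joined w (u v : 'I_V) : bool :=
  [exists i, (w.1.1 (i, false) == u) && (w.1.1 (i, true) == v)].

(** Joined vertices give connectedness, positive exponents of [p j0] give full reducedness, and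
    distinct exponents give condition (3) and, together with the last hypothesis, condition (2). *)
Lemma flexible_random_gbs w j0 :
  (forall u v, u != v -> joined w u v) ->
  (forall e, w.2 (e, j0) != 0 :> nat) ->
  (forall e f j, e != f -> w.2 (e, j) != w.2 (f, j)) ->
  (forall i, ~~ no_edge_below w i) ->
  flexible (random_gbs p_prime w).
Proof.
move=> w_join w_pos w_inj w_below.
have Gconn : connected_graph (random_gbs p_prime w).
  move=> u v; have [->|uv] := eqVneq u v; first exact: connect0.
  have /existsP[i /andP[iu iv]] := w_join u v uv.
  by apply: connect1; apply/existsP; exists (i, false); rewrite inE /= iu.
have label_lt e f : e != f -> (random_label p w e %| random_label p w f)%Z ->
    forall j, (w.2 (e, j) < w.2 (f, j))%N.
  by move=> ef /dvd_random_label_exp h j; rewrite ltn_neqAle h andbT w_inj.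
split=> //.
- apply: (fully_reduced_prime_dvd_labels Gconn (p_prime j0)) => e.
  rewrite dvdzE absz_random_label (bigD1 j0) //= dvdn_mulr //.
  by rewrite dvdn_exp // lt0n w_pos.
- case=> e [e_min er_min].
  (* An edge below [g] would contradict its minimality: the exponents at [j0] differ, so the labels
     are not equal up to sign. *)
  have minimalP (g : oedge E) : @minimal_edge (random_gbs p_prime w) g ->
      forall f, f != g -> ~~ edge_below w f g.
    move=> g_min f fg; apply/negP => /andP[/eqP fg_v /forallP fg_exp].
    apply: g_min; exists f; split=> //=; first exact: dvd_random_label.
      apply: contra (w_inj f g j0 fg) => /eqP fgE; apply/eqP/val_inj.
      by rewrite /= -!logn_random_label /= fgE.
    apply: contra (w_inj f g j0 fg) => /eqP fgE; apply/eqP/val_inj.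
    by rewrite /= -!logn_random_label /= fgE abszN.
  move: e e_min er_min => [i b] /minimalP e_min /minimalP er_min.
  have /negP := w_below i; apply; apply/forall_inP => f /andP[f0 f1].
  by case: b e_min er_min => e_min er_min; rewrite e_min ?er_min.
- move=> e f ef _ dvd_ef r /prime_set_random_gbs[k ->].
  have /dvdzP[c] : (random_label p w e %| random_label p w f)%Z by [].
  move: (label_lt e f ef dvd_ef) => /(mul_dvd_random_label k).
  have e_neq0 := random_label_neq0 p_prime w e.
  move=> + fE; rewrite fE dvdz_mul2r // => dvd_c.
  suff : (p k %| random_label p w f %/ random_label p w e)%Z by [].
  by rewrite fE mulzK.
Qed.

End DivisibilityOfLabels.

(** * Uniform probability on finite types *)

Lemma card_ffun_forall (I J : finType) (P : I -> pred J) :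
  #|[pred x : {ffun I -> J} | [forall i, P i (x i)]]| = (\prod_i #|P i|)%N.
Proof.
transitivity #|family P|; last by rewrite card_family foldrE big_image.
by apply: eq_card => x; rewrite [LHS]inE; apply/forallP/familyP.
Qed.

(** Conditioning on the value at [a]: once it is [u], the other coordinates are constrained
    independently and the count factors. *)
Lemma card_ffun_pivot (I J : finType) (a : I) (P : J -> I -> pred J) :
  #|[pred x : {ffun I -> J} | [forall (i | i != a), P (x a) i (x i)]]|
    = (\sum_(u : J) \prod_(i | i != a) #|P u i|)%N.
Proof.
rewrite -sum1_card (partition_big (fun x : {ffun I -> J} => x a) xpredT) //=.
apply: eq_bigr => u _; rewrite sum1dep_card.
transitivity (\prod_i #|if i == a then pred1 u : pred J else P u i|)%N.
  rewrite -card_ffun_forall; apply: eq_card => x; rewrite !inE.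
  apply/andP/forallP => [[/forallP Px /eqP xa] i|Px].
    by have := Px i; rewrite -xa; case: eqVneq => [->|//]; rewrite inE.
  have /eqP xa : x a == u by have := Px a; rewrite eqxx.
  rewrite xa eqxx; split=> //.
  by apply/forallP => i; have := Px i; case: eqVneq.
rewrite (bigD1 a) //= eqxx card1 mul1n; apply: eq_bigr => i /negPf ia.
by rewrite ia.
Qed.

Section UniformProbability.
Variable R : realType.

(** On an empty type this is 0, since division by zero gives 0; hence the nonemptiness assumption
    for complements. *)
Definition Pr (T : finType) (P : pred T) : R := #|P|%:R / #|T|%:R.

Lemma Pr_ge0 (T : finType) (P : pred T) : 0 <= Pr P.
Proof. by rewrite divr_ge0. Qed.

Lemma Pr_le1 (T : finType) (P : pred T) : Pr P <= 1.
Proof.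
have [T0|T_gt0] := posnP #|T|; first by rewrite /Pr T0 invr0 mulr0.
by rewrite ler_pdivrMr ?ltr0n // mul1r ler_nat max_card.
Qed.

Lemma Pr_compl (T : finType) (P : pred T) : (0 < #|T|)%N ->
  Pr P = 1 - Pr [predC P].
Proof.
move=> T_gt0; apply/eqP; rewrite eq_sym subr_eq -mulrDl -natrD cardC.
by rewrite divff // pnatr_eq0 -lt0n.
Qed.

Lemma sub_Pr (T : finType) (P Q : pred T) : {subset P <= Q} -> Pr P <= Pr Q.
Proof.
move=> PQ; rewrite ler_wpM2r ?invr_ge0 // ler_nat subset_leq_card //.
exact/fintype.subsetP.
Qed.

Lemma Pr_predU (T : finType) (P Q : pred T) : Pr [predU P & Q] <= Pr P + Pr Q.
Proof.
rewrite -mulrDl ler_wpM2r ?invr_ge0 // -natrD ler_nat.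
by rewrite -(cardUI P Q) leq_addr.
Qed.

Lemma Pr_exists (T I : finType) (P : I -> pred T) (B : R) :
  (forall i, Pr (P i) <= B) ->
  Pr [pred x | [exists i, P i x]] <= #|I|%:R * B.
Proof.
move=> PB; apply: (@le_trans _ _ (\sum_i Pr (P i))); last first.
  by rewrite mulr_natl -sumr_const ler_sum.
rewrite -mulr_suml ler_wpM2r ?invr_ge0 // -natr_sum ler_nat.
pose S i := [set x | P i x]%SET.
have -> : #|[pred x | [exists i, P i x]]| = #|\bigcup_i S i|%SET.
  apply: eq_card => x; rewrite !inE; apply/existsP/bigcupP => [[i Pi]|[i _]].
    by exists i; rewrite ?inE.
  by rewrite inE => Pi; exists i.
elim/big_rec2: _ => [|i m A _ Am]; first by rewrite cards0.
rewrite (leq_trans (leq_card_setU _ _)) // leq_add //.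
by rewrite cardsE.
Qed.

(** Such an [f] is a bijection; this moves events between two groupings of the same random data. *)
Lemma Pr_inj (T T' : finType) (f : T -> T') (Q : pred T') :
  injective f -> #|T| = #|T'| -> Pr (fun x => Q (f x)) <= Pr Q.
Proof.
move=> f_inj TT'; rewrite /Pr TT' ler_wpM2r ?invr_ge0 // ler_nat.
rewrite -(fintype.card_image f_inj) subset_leq_card //.
by apply/fintype.subsetP => _ /fintype.imageP[x Qx ->].
Qed.

Lemma Pr_snd (T T' : finType) (Q : pred T') : (0 < #|T|)%N ->
  Pr (fun x : T * T' => Q x.2) = Pr Q.
Proof.
move=> T_gt0; rewrite /Pr card_prod.
have -> : #|(fun x : T * T' => Q x.2)| = (#|T| * #|Q|)%N.
  by rewrite -cardX; apply: eq_card => -[x y]; rewrite !inE.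
by rewrite !natrM invfM mulrACA divff ?mul1r // pnatr_eq0 -lt0n.
Qed.

Lemma Pr_fst (T T' : finType) (Q : pred T) : (0 < #|T'|)%N ->
  Pr (fun x : T * T' => Q x.1) = Pr Q.
Proof.
move=> T_gt0; rewrite /Pr card_prod.
have -> : #|(fun x : T * T' => Q x.1)| = (#|Q| * #|T'|)%N.
  by rewrite -cardX; apply: eq_card => -[x y]; rewrite !inE andbT.
by rewrite !natrM invfM mulrACA divff ?mulr1 // pnatr_eq0 -lt0n.
Qed.

Lemma Pr_ffun_coincide (I J : finType) (a b : I) : a != b -> (0 < #|J|)%N ->
  Pr (fun x : {ffun I -> J} => x a == x b) = #|J|%:R^-1.
Proof.
move=> ab J_gt0.
have J_neq0 : (#|J|%:R : R) != 0 by rewrite pnatr_eq0 -lt0n.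
rewrite /Pr card_ffun.
transitivity ((#|J| * #|J| ^ (#|I| - 2))%:R / (#|J| ^ #|I|)%:R : R).
  congr (_%:R / _); transitivity (#|[pred x : {ffun I -> J} |
      [forall (i | i != a),
         (if i == b then pred1 (x a) : pred J else predT) (x i)]]|).
    apply: eq_card => x; rewrite !inE; apply/idP/forall_inP => [/eqP xab i ia|].
      by case: (eqVneq i b) => // ->; rewrite /= -xab.
    move/(_ b); rewrite /= eqxx (eq_sym b) ab => /(_ isT) /eqP xba.
    exact/eqP.
  rewrite (card_ffun_pivot a
    (fun u i => if i == b then pred1 u : pred J else predT)).
  rewrite -sum_nat_const; apply: eq_bigr => u _.
  rewrite (bigD1 b) /= 1?eq_sym // eqxx card1 mul1n.
  rewrite (eq_bigr (fun _ => #|J|)) => [|i /andP[_ /negPf->]] //.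
  rewrite prod_nat_const; congr (_ ^ _)%N.
  rewrite -(cardC (pred2 a b)) card2 ab addKn.
  by apply: eq_card => i; rewrite !inE negb_or.
(* As [a] and [b] are distinct, the truncated subtraction of 2 is exact. *)
have [k ->] : exists k, #|I| = k.+2.
  have : (1 < #|I|)%N.
    by apply: leq_trans (max_card (pred2 a b)); rewrite card2 ab.
  by case: #|I| => [|[|k]] // _; exists k.
rewrite subSS subSS subn0 -expnS [in X in _ / X]expnS [X in _ / X]natrM.
by rewrite invfM mulrCA divff ?mulr1 // natrX expf_neq0.
Qed.

Lemma Pr_ffun_point (I J : finType) (a : I) (u : J) :
  Pr (fun x : {ffun I -> J} => x a == u) = #|J|%:R^-1.
Proof.
have J_neq0 : (#|J|%:R : R) != 0.
  by rewrite pnatr_eq0 -lt0n; apply/card_gt0P; exists u.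
rewrite /Pr card_ffun.
transitivity ((#|J| ^ #|I|.-1)%:R / (#|J| ^ #|I|)%:R : R).
  congr (_%:R / _); transitivity (#|[pred x : {ffun I -> J} |
      [forall i, (if i == a then pred1 u : pred J else predT) (x i)]]|).
    apply: eq_card => x; rewrite !inE; apply/idP/forallP => [/eqP xau i|].
      by case: (eqVneq i a) => // ->; rewrite /= xau.
    by move/(_ a); rewrite eqxx.
  rewrite (card_ffun_forall
    (fun i => if i == a then pred1 u : pred J else predT)).
  rewrite (bigD1 a) //= eqxx card1 mul1n.
  rewrite (eq_bigr (fun _ => #|J|)) => [|i /negPf->] //.
  by rewrite prod_nat_const cardC1.
have [k ->] : exists k, #|I| = k.+1.
  have : (0 < #|I|)%N by apply/card_gt0P; exists a.
  by case: #|I| => // k _; exists k.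
rewrite /= [in X in _ / X]expnS [X in _ / X]natrM invfM mulrCA.
by rewrite divff ?mulr1 // natrX expf_neq0.
Qed.

End UniformProbability.

(** * Real estimates *)

Section RealEstimates.
Variable R : realType.
Implicit Types (x y r s m : R).

(** In logarithms this is [s * ln y <= y]: clear if [ln y <= 0], and otherwise
    [s * ln y <= ln y <= y]. *)
Lemma expRN_le_powR y s : 0 < y -> 0 <= s <= 1 -> expR (- y) <= y `^ (- s).
Proof.
move=> y_gt0 /andP[s_ge0 s_le1]; rewrite /powR gt_eqF // ler_expR mulNr lerN2.
have [ln_ge|/ltW ln_le] := leP 0 (ln y); last first.
  by rewrite (le_trans _ (ltW y_gt0)) // mulr_ge0_le0.
by rewrite (le_trans (ler_piMl ln_ge s_le1)) // ltW // ln_sublinear.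
Qed.

(** Young's inequality for the r-th power of [x] and 1, with conjugate exponents [1 / r] and
    [1 / (1 - r)]. *)
Lemma powR_bernoulli x r : 0 <= x -> 0 < r < 1 -> x `^ r <= 1 + r * (x - 1).
Proof.
move=> x_ge0 /andP[r_gt0 r_lt1].
have r1_gt0 : 0 < 1 - r by rewrite subr_gt0.
have := @conjugate_powR R (x `^ r) 1 r^-1 (1 - r)^-1 (powR_ge0 _ _) ler01.
rewrite !invr_gt0 !invrK mulr1 powR1 mul1r -powRrM divff ?gt_eqF // powRr1 //.
by move=> /(_ r_gt0 r1_gt0); rewrite addrC subrK => /(_ erefl); lra.
Qed.

(** Comparison with the integral of t^(-s); the induction step is Bernoulli's inequality at
    [n / n.+1]. *)
Lemma sum_powRN_le s n : 0 < s < 1 ->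
  \sum_(k < n) (k.+1%:R : R) `^ (- s) <= n%:R `^ (1 - s) / (1 - s).
Proof.
move=> /andP[s_gt0 s_lt1]; have s1_gt0 : 0 < 1 - s by rewrite subr_gt0.
elim: n => [|n IHn]; first by rewrite big_ord0 divr_ge0 ?powR_ge0 ?ltW.
rewrite big_ord_recr /=; apply: (le_trans (lerD IHn (lexx _))).
rewrite -[X in _ + X](@mulfK _ (1 - s)) ?gt_eqF // -mulrDl.
rewrite ler_pM2r ?invr_gt0 //.
have n1_gt0 : 0 < n.+1%:R :> R by rewrite ltr0n.
have n_le : n%:R `^ (1 - s) / n.+1%:R `^ (1 - s) <=
            1 + (1 - s) * (n%:R / n.+1%:R - 1).
  rewrite -powRN -[X in _ * X `^ _](invrK n.+1%:R) -powR_inv1 ?invr_ge0 //.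
  rewrite -powRrM mulrNN mul1r -powRM ?invr_ge0 //.
  by apply: powR_bernoulli; rewrite ?divr_ge0 // s1_gt0 ltrBlDr ltrDl s_gt0.
have pow_gt0 := powR_gt0 (1 - s) n1_gt0.
rewrite ler_pdivrMr // in n_le; rewrite -lerBrDr (le_trans n_le) //.
have -> : n.+1%:R `^ (- s) = n.+1%:R `^ (1 - s) / n.+1%:R :> R.
  rewrite -[in RHS]powR_inv1 // -powRD; last by rewrite (gt_eqF n1_gt0) implybT.
  by congr (_ `^ _); ring.
rewrite le_eqVlt; apply/orP; left; apply/eqP; rewrite -natr1 in n1_gt0 *.
by field; rewrite gt_eqF.
Qed.

Lemma sum_powRN_div_le s n : 0 < s < 1 ->
  \sum_(k < n) (k.+1%:R / n%:R : R) `^ (- s) <= n%:R / (1 - s).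
Proof.
move=> s01; have [->|n_gt0] := posnP n; first by rewrite big_ord0 mul0r.
have n_gt0R : 0 < n%:R :> R by rewrite ltr0n.
have nE : n%:R = n%:R `^ s * n%:R `^ (1 - s) :> R.
  rewrite -powRD; last by rewrite (gt_eqF n_gt0R) implybT.
  by rewrite addrC subrK powRr1.
rewrite [X in _ <= X / _]nE -mulrA.
rewrite (eq_bigr (fun k : 'I_n => n%:R `^ s * k.+1%:R `^ (- s))) => [|k _].
  by rewrite -mulr_sumr ler_wpM2l ?powR_ge0 // sum_powRN_le.
rewrite powRM ?invr_ge0 // mulrC -powR_inv1 // -powRrM mulrNN mul1r.
by [].
Qed.

Lemma powR_prod (I : finType) (F : I -> R) r : (forall i, 0 <= F i) ->
  (\prod_i F i) `^ r = \prod_i F i `^ r.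
Proof.
(* The invariant carries the nonnegativity of partial products, which [powRM] requires. *)
move=> F_ge0; pose K x y := 0 <= x /\ x `^ r = y.
suff [] : K (\prod_i F i) (\prod_i F i `^ r) by [].
elim/big_rec2: _ => [|i x y _ [x_ge0 <-]]; first by rewrite /K powR1.
by split; rewrite ?mulr_ge0 // powRM.
Qed.

(** The proportion of exponent vectors that lie coordinatewise below [u]; an exponent [k] leaves
    [k + 1] choices. *)
Definition volume (D N : nat) (u : {ffun 'I_D -> 'I_N}) : R :=
  \prod_j ((u j).+1%:R / N%:R).

Lemma volume_gt0 D N (u : {ffun 'I_D -> 'I_N}) : 0 < volume u.
Proof.
apply: prodr_gt0 => j _; rewrite divr_gt0 ?ltr0n //.
by case: N u => // u; case: (u j).
Qed.

(** Trading the exponential for a power turns the sum over exponent vectors into a product over the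
    [D] primes. *)
Lemma sum_expRN_volume D N m s : 0 < m -> 0 < s < 1 ->
  \sum_(u : {ffun 'I_D -> 'I_N}) expR (- (m * volume u))
    <= m `^ (- s) * (N%:R / (1 - s)) ^+ D.
Proof.
move=> m_gt0 s01.
apply: (@le_trans _ _ (m `^ (- s) *
    \sum_(u : {ffun 'I_D -> 'I_N}) volume u `^ (- s))).
  rewrite mulr_sumr ler_sum // => u _.
  rewrite -powRM ?(ltW m_gt0) ?(ltW (volume_gt0 u)) //.
  apply: expRN_le_powR; first by rewrite mulr_gt0 ?volume_gt0.
  by case/andP: s01 => /ltW-> /ltW->.
rewrite ler_wpM2l ?powR_ge0 //.
rewrite (eq_bigr (fun u : {ffun 'I_D -> 'I_N} =>
           \prod_j ((u j).+1%:R / N%:R) `^ (- s))) => [|u _].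
  rewrite -(bigA_distr_bigA (fun _ (k : 'I_N) => (k.+1%:R / N%:R) `^ (- s))) /=.
  rewrite prodr_const card_ord lerXn2r ?nnegrE ?sum_powRN_div_le //.
    by rewrite sumr_ge0 // => k _; apply: powR_ge0.
  by rewrite divr_ge0 // subr_ge0; case/andP: s01 => _ /ltW.
by rewrite powR_prod // => j; rewrite divr_ge0.
Qed.
End RealEstimates.

(** * Numerical estimate of the failure probability *)

Section FailureBound.
Variable R : realType.
Implicit Types (eps L l : R).

(** The left side is [(1 - s)^-1] for [s = 1 - eps / 20]. For such small [eps] the fourth-order term
    of the exponential series is large enough. *)
Lemma inv_eps_le_expR eps : 0 < eps < 1 / 50%:R ->
  20%:R / eps <= expR (28%:R / 100%:R / eps).
Proof.
move=> /andP[eps_gt0 eps_lt].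
have y_gt : 50%:R < eps^-1.
  by rewrite -(invrK 50%:R) ltf_pV2 ?posrE ?invr_gt0 // -div1r.
set y := eps^-1 in y_gt *.
have x_ge0 : 0 <= 28%:R / 100%:R * y by lra.
apply: le_trans (expR_ge1Dxn 3 x_ge0); rewrite !factS fact0.
have y3 : 50%:R ^+ 3 <= y ^+ 3 by rewrite lerXn2r ?nnegrE //; lra.
have -> : (28%:R / 100%:R * y) ^+ 4 =
          (28%:R / 100%:R) ^+ 4 * (y * y ^+ 3) by ring.
have : y * 50%:R ^+ 3 <= y * y ^+ 3 by rewrite ler_pM2l //; lra.
lra.
Qed.

(** For [L = ln E] and [l = ln V] the left side bounds the logarithm of the first failure term. With
    [t] as below and up to smaller terms, the main part contributes [- t], the gap between [s] and 1
    costs [t / 10] and the factor in [D] costs [0.56 t], which leaves more than the required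
    [t / 4]. *)
Lemma minimal_exponent_le eps L l (D : nat) : 0 < eps < 1 / 50%:R ->
  (2%:R + eps) * l <= L ->
  2%:R * D%:R <= eps ^+ 2 * L -> 2%:R <= eps ^+ 2 * L ->
  L - 2%:R * (1 - eps / 20%:R) * (L - l - 1)
    + 28%:R / 100%:R / eps * (2%:R * D%:R)
    <= - (eps / 8%:R * L) - 1.
Proof.
move=> /andP[eps_gt0 eps_lt] lL DL L_ge.
have D_le : 28%:R / 100%:R / eps * (2%:R * D%:R) <= 28%:R / 100%:R * (eps * L).
  have -> : 28%:R / 100%:R * (eps * L) = 28%:R / 100%:R / eps * (eps ^+ 2 * L).
    by field; rewrite gt_eqF.
  by rewrite ler_wpM2l // divr_ge0 ?ltW //; lra.
apply: le_trans (lerD (lexx _) D_le) _.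
(* The largest value that [l] can take; [t = eps * a] is then about half of [eps * L]. *)
pose a := L / (2%:R + eps).
have eps2_gt0 : 0 < 2%:R + eps by lra.
have LE : L = (2%:R + eps) * a by rewrite mulrC divfK // gt_eqF.
have la : l <= a by rewrite ler_pdivlMr // mulrC.
have epsL : 100%:R <= eps * L.
  have epsL_gt0 : 0 < eps * L.
    by rewrite -(pmulr_rgt0 _ eps_gt0) mulrA -expr2 (lt_le_trans _ L_ge).
  have : 2%:R <= 1 / 50%:R * (eps * L).
    by apply: le_trans L_ge _; rewrite expr2 -mulrA ler_pM2r // ltW.
  lra.
have s_ge : 0 <= 1 - eps / 20%:R by lra.
have : (1 - eps / 20%:R) * l <= (1 - eps / 20%:R) * a by rewrite ler_wpM2l.
move: epsL; rewrite LE; set t := eps * a.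
have eps_t : 0 < t -> eps * t <= 1 / 50%:R * t.
  by move=> t0; rewrite ler_pM2r // ltW.
have -> : eps * ((2%:R + eps) * a) = 2%:R * t + eps * t by rewrite /t; ring.
have -> : eps / 8%:R * ((2%:R + eps) * a) = (2%:R * t + eps * t) / 8%:R.
  by rewrite /t; field.
have t_gt0 : 100%:R <= 2%:R * t + eps * t -> 0 < t.
  rewrite -mulrDl => h; rewrite -(pmulr_rgt0 _ eps2_gt0); lra.
move=> t_ge al; have := t_gt0 t_ge => {}t_gt0; have {}eps_t := eps_t t_gt0.
have -> : (2%:R + eps) * a
    - 2%:R * (1 - eps / 20%:R) * ((2%:R + eps) * a - l - 1)
  = 2%:R * a + t - 2%:R * (2%:R * a + t) + eps / 10%:R * (2%:R * a)
    + eps * t / 10%:R + 2%:R * ((1 - eps / 20%:R) * l)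
    + 2%:R * (1 - eps / 20%:R).
  by rewrite /t; field.
have : (1 - eps / 20%:R) * a = a - t / 20%:R by rewrite /t; ring.
have : eps / 10%:R * (2%:R * a) = t / 5%:R by rewrite /t; field.
by lra.
Qed.

(** Since [L - 2 l >= t >= 49] and [a <= 1.02 t^2], the cubic term of the exponential series gives
    at least [8 a], against [2 l <= 2 a]. *)
Lemma unjoined_exponent_le eps L l : 0 < eps < 1 / 50%:R ->
  (2%:R + eps) * l <= L -> 2%:R <= eps ^+ 2 * L ->
  2%:R * l - expR (L - 2%:R * l) <= - (eps / 8%:R * L) - 1.
Proof.
move=> /andP[eps_gt0 eps_lt] lL L_ge.
pose a := L / (2%:R + eps).
have eps2_gt0 : 0 < 2%:R + eps by lra.
have LE : L = (2%:R + eps) * a by rewrite mulrC divfK // gt_eqF.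
have la : l <= a by rewrite ler_pdivlMr // mulrC.
have L_gt0 : 0 < L by rewrite -(pmulr_rgt0 _ (exprn_gt0 2 eps_gt0)); lra.
have a_gt0 : 0 < a by rewrite divr_gt0.
pose t := eps * a.
have t_gt0 : 0 < t by rewrite mulr_gt0.
have epst : eps * t <= 1 / 50%:R * t by rewrite ler_pM2r // ltW.
have t_ge : 49%:R <= t.
  move: L_ge; rewrite LE.
  have -> : eps ^+ 2 * ((2%:R + eps) * a) = eps * (2%:R * t + eps * t).
    by rewrite /t; ring.
  have : eps * (2%:R * t + eps * t) <= 1 / 50%:R * (2%:R * t + eps * t).
    by rewrite ler_pM2r ?ltW // addr_gt0 // mulr_gt0.
  lra.
have a_le : a <= 102%:R / 100%:R * t ^+ 2.
  have : 2%:R * a <= eps ^+ 2 * L * a by rewrite ler_pM2r.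
  have -> : eps ^+ 2 * L * a = (2%:R + eps) * t ^+ 2.
    by rewrite LE /t; ring.
  have : (2%:R + eps) * t ^+ 2 <= (2%:R + 1 / 50%:R) * t ^+ 2.
    by rewrite ler_pM2r ?exprn_gt0 // lerD2l ltW.
  lra.
have exp_ge : 8%:R * a <= expR (L - 2%:R * l).
  have : expR t <= expR (L - 2%:R * l).
    rewrite ler_expR LE.
    have -> : (2%:R + eps) * a - 2%:R * l = t + 2%:R * (a - l).
      by rewrite /t; ring.
    by rewrite lerDl mulr_ge0 // subr_ge0.
  apply: le_trans; apply: le_trans (expR_ge1Dxn 2 (ltW t_gt0)).
  rewrite !factS fact0.
  have : 49%:R * t ^+ 2 <= t ^+ 3 by rewrite [t ^+ 3]exprS ler_pM2r ?exprn_gt0.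
  lra.
have : eps / 8%:R * L = (2%:R * t + eps * t) / 8%:R by rewrite LE /t; field.
have : t <= 1 / 50%:R * a by rewrite ler_pM2r // ltW.
lra.
Qed.

(** Each of the two terms is at most [exp (- eps L / 8 - 1)]; the [- 1] pays for adding them, as e
    is at least 2. *)
Lemma failure_bound_le eps (V E D : nat) : 0 < eps < 1 / 50%:R ->
  (0 < V)%N -> (0 < E)%N -> (0 < D)%N ->
  V%:R `^ (2%:R + eps) <= E%:R ->
  expR (2%:R * D%:R / eps ^+ 2) <= E%:R ->
  E%:R * (((E.-1%:R / V%:R) `^ (- (1 - eps / 20%:R))) *
           (1 - (1 - eps / 20%:R))^-1 ^+ D) ^+ 2
    + V%:R ^+ 2 * expR (- (E%:R / V%:R ^+ 2))
  <= 1 / E%:R `^ (eps / 8%:R) /\ (1 < E)%N.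
Proof.
move=> eps01 V_gt0 E_gt0 D_gt0 hEV hED; have /andP[eps_gt0 eps_lt] := eps01.
have V_gt0R : 0 < V%:R :> R by rewrite ltr0n.
have E_gt0R : 0 < E%:R :> R by rewrite ltr0n.
pose L : R := ln E%:R; pose l : R := ln V%:R.
have EL : E%:R = expR L by rewrite lnK.
have Vl : V%:R = expR l by rewrite lnK.
have lL : (2%:R + eps) * l <= L.
  by move: hEV; rewrite /powR gt_eqF // EL ler_expR.
have eps2_gt0 : 0 < eps ^+ 2 by rewrite exprn_gt0.
have DL : 2%:R * D%:R <= eps ^+ 2 * L.
  by move: hED; rewrite EL ler_expR ler_pdivrMr // [L * _]mulrC.
have L_ge : 2%:R <= eps ^+ 2 * L.
  by apply: le_trans DL; rewrite ler_pMr // ler1n.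
have L_gt1 : 1 < L.
  have : eps ^+ 2 <= 1 by rewrite expr_le1 //; lra.
  move=> eps2_le1; have : eps ^+ 2 * L <= 1 * L.
    rewrite ler_wpM2r // ltW // -(pmulr_rgt0 _ eps2_gt0); lra.
  lra.
have e_ge2 : 2%:R <= expR 1 :> R by have := expR_ge1Dx (1 : R); lra.
have E_gt1 : (1 < E)%N.
  rewrite -(ltr1n R) EL; apply: lt_le_trans (_ : expR 1 <= _); first by lra.
  by rewrite ler_expR ltW.
split=> //.
have half : expR (- (eps / 8%:R * L) - 1) + expR (- (eps / 8%:R * L) - 1)
             <= 1 / E%:R `^ (eps / 8%:R).
  rewrite /powR gt_eqF // -/L div1r -expRN expRD -mulrDr.
  rewrite -[leRHS]mulr1 ler_wpM2l ?expR_ge0 //.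
  rewrite expRN.
  have : (expR 1)^-1 <= 2%:R^-1 :> R by rewrite lef_pV2 ?posrE //; lra.
  lra.
apply: le_trans half; apply: lerD; last first.
  apply: le_trans (_ : expR (2%:R * l - expR (L - 2%:R * l)) <= _).
    rewrite expRD EL Vl -expRM_natl.
    rewrite -expRN -expRD.
    by rewrite mulr_natl.
  by rewrite ler_expR; apply: unjoined_exponent_le.
apply: le_trans (_ : expR (L - 2%:R * (1 - eps / 20%:R) * (L - l - 1)
     + 28%:R / 100%:R / eps * (2%:R * D%:R)) <= _); last first.
  by rewrite ler_expR; apply: minimal_exponent_le.
have s_ge0 : 0 <= 1 - eps / 20%:R by lra.
have pow_le : (E.-1%:R / V%:R) `^ (- (1 - eps / 20%:R)) <=
              expR (- ((1 - eps / 20%:R) * (L - l - 1))).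
  (* As [E] and e are at least 2, [E - 1 >= E / e]; hence the [- 1] in the exponent. *)
  have m_ge : expR (L - l - 1) <= E.-1%:R / V%:R.
    rewrite !expRD !expRN -EL -Vl mulrAC ler_pM2r ?invr_gt0 //.
    have : E%:R = 1 + E.-1%:R :> R by rewrite nat1r prednK.
    have : 1 <= E.-1%:R :> R by rewrite ler1n; lia.
    rewrite ler_pdivrMr ?expR_gt0 //.
    move=> E1 EE; rewrite EE.
    have : E.-1%:R * 2%:R <= E.-1%:R * expR 1 :> R by rewrite ler_wpM2l.
    lra.
  have m_gt0 : 0 < E.-1%:R / V%:R :> R.
    by apply: lt_le_trans m_ge; exact: expR_gt0.
  rewrite /powR gt_eqF // ler_expR mulNr lerN2 ler_wpM2l //.
  by rewrite -ler_expR lnK // posrE.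
have inv_le : (1 - (1 - eps / 20%:R))^-1 <= expR (28%:R / 100%:R / eps).
  apply: le_trans (inv_eps_le_expR eps01).
  by rewrite subKr invf_div.
have inv_ge0 : 0 <= (1 - (1 - eps / 20%:R))^-1 by rewrite subKr invr_ge0; lra.
rewrite !expRD -EL -mulrA ler_pM2l //.
have -> : expR (- (2%:R * (1 - eps / 20%:R) * (L - l - 1))) *
  expR (28%:R / 100%:R / eps * (2%:R * D%:R)) =
  (expR (- ((1 - eps / 20%:R) * (L - l - 1))) *
   expR (28%:R / 100%:R / eps) ^+ D) ^+ 2.
  rewrite -expRM_natl -!expRD -expRM_natl; congr expR; ring.
rewrite lerXn2r ?nnegrE ?mulr_ge0 ?exprn_ge0 ?powR_ge0 ?expR_ge0 //.
rewrite ler_pM ?powR_ge0 ?exprn_ge0 //.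
by rewrite lerXn2r // nnegrE expR_ge0.
Qed.
End FailureBound.

(** * Lower limit of a sequence with error of order 1/n *)

Section Limit.
Variable R : realType.

Lemma le_limn_inf_div (u : nat -> R) (b C : R) : 0 <= C ->
  (forall n, 0 <= u n <= 1) ->
  (forall n, (0 < n)%N -> b - C / n%:R <= u n) -> b <= limn_inf u.
Proof.
move=> C_ge0 u01 u_ge.
have u_bnd : bounded_fun u.
  exists 1; split=> [|x x1 n _ /=]; first exact: num_real.
  by case/andP: (u01 n) => u0 u1; rewrite ger0_norm // (le_trans u1) // ltW.
rewrite limn_infE //; apply/ler_addgt0Pr => e e_gt0.
(* From this index on [C / k <= e]; the successor also keeps [k] positive. *)
pose n := (Num.truncn (C / e)).+1.
rewrite -lerBlDr; apply: (@le_trans _ _ (infs u n)); last first.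
  by apply: ub_le_sup; [exact: bounded_fun_has_ubound_infs | exists n].
apply: lb_le_inf; first by exists (u n), n => /=.
move=> _ [k /= nk <-]; have k_gt0 : (0 < k)%N by apply: leq_trans nk.
apply: le_trans (u_ge k k_gt0); rewrite lerD2l lerN2.
rewrite ler_pdivrMr ?ltr0n // mulrC -ler_pdivrMr //.
by rewrite ltW // (lt_le_trans (truncnS_gt _)) // ler_nat.
Qed.
End Limit.

(** * The random GBS graph *)

Section RandomGraphEvents.
Variable R : realType.

(** One coordinate per topological edge, so that the two ends of an edge can serve together as the
    pivot. *)
Definition edge_pairs (J : finType) (E : nat) (x : {ffun oedge E -> J}) :
    {ffun 'I_E -> J * J} :=
  [ffun i => (x (i, false), x (i, true))].

Lemma Pr_edge_pairs (J : finType) E (Q : pred {ffun 'I_E -> J * J}) :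
  Pr R (fun x : {ffun oedge E -> J} => Q (edge_pairs x)) <= Pr R Q.
Proof.
apply: Pr_inj => [x y xyE|].
  apply/ffunP => -[i b]; have := congr1 (fun z : {ffun _ -> _} => z i) xyE.
  by rewrite !ffunE => -[xyf xyt]; case: b.
by rewrite !card_ffun !card_prod card_ord card_bool mulnC expnM mulnn.
Qed.

(** Each of the [E] independent pairs misses [(u, v)] with probability [1 - 1 / V^2], which is at
    most [exp (- 1 / V^2)]. *)
Lemma Pr_unjoined (V E D N : nat) (u v : 'I_V) : (0 < N)%N ->
  Pr R (fun w : outcome V E D N => ~~ joined w u v)
    <= expR (- (E%:R / V%:R ^+ 2)).
Proof.
move=> N_gt0; have V_gt0 : (0 < V)%N by case: V u {v} => // -[].
pose Q (y : {ffun 'I_E -> 'I_V * 'I_V}) := [forall i, y i != (u, v)].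
apply: (@le_trans _ _ (Pr R Q)).
  apply: le_trans (Pr_edge_pairs Q).
  pose Q1 (x : {ffun oedge E -> 'I_V}) := Q (edge_pairs x).
  rewrite -(@Pr_fst R _ {ffun oedge E -> bool} Q1); last first.
    by rewrite card_ffun card_bool expn_gt0.
  rewrite -(@Pr_fst R _ {ffun oedge E * 'I_D -> 'I_N} (fun x => Q1 x.1));
    last first.
    by rewrite card_ffun card_ord expn_gt0 N_gt0.
  apply: sub_Pr => w; rewrite unfold_in negb_exists => /forallP w_not.
  apply/forallP => i; have := w_not i; rewrite ffunE; apply: contra.
  by case/eqP=> -> ->; rewrite !eqxx.
have V2_gt0 : 0 < (V ^ 2)%:R :> R by rewrite ltr0n expn_gt0 V_gt0.
rewrite /Pr (card_ffun_forall (fun=> predC1 (u, v))) prod_nat_const.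
rewrite card_ffun cardC1 card_prod !card_ord mulnn !natrX -expr_div_n.
rewrite -mulrN expRM_natl lerXn2r ?nnegrE ?divr_ge0 ?expR_ge0 //.
apply: le_trans (expR_ge1Dx _); rewrite -natrX ler_pdivrMr //.
rewrite mulrDl mul1r mulNr mulVf ?gt_eqF // lerBrDr natr1 prednK //.
by rewrite expn_gt0 V_gt0.
Qed.

(** The sign is kept so that [data_of] is injective between types of equal cardinality. *)
Definition edge_data (V D N : nat) : finType :=
  ('I_V * {ffun 'I_D -> 'I_N} * bool)%type.

(* The first component is the target of e, i.e. the source of its reverse. *)
Definition data_of (V E D N : nat) (w : outcome V E D N) :
    {ffun oedge E -> edge_data V D N} :=
  [ffun e => (w.1.1 (oedge_rev e), [ffun j => w.2 (e, j)], w.1.2 e)].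

(** Reversal permutes the oriented edges, so targets are as independent and uniform as sources. *)
Lemma Pr_data_of V E D N (Q : pred {ffun oedge E -> edge_data V D N}) :
  Pr R (fun w : outcome V E D N => Q (data_of w)) <= Pr R Q.
Proof.
apply: Pr_inj => [[[w1 w2] w3] [[z1 z2] z3] wzE|].
  have wz e : [/\ w1 (oedge_rev e) = z1 (oedge_rev e), w2 e = z2 e
                & forall j, w3 (e, j) = z3 (e, j)].
    have := congr1 (fun z : {ffun _ -> _} => z e) wzE.
    rewrite !ffunE /= => -[-> /ffunP w3E ->]; split=> // j.
    by have := w3E j; rewrite !ffunE.
  congr (_, _, _); apply/ffunP => e.
  - by case: (wz (oedge_rev e)); rewrite oedge_revK.
  - by case: (wz e).
  - by case: e => e j; case: (wz e).
rewrite !card_prod !card_ffun !card_prod card_ffun !card_ord card_bool.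
by rewrite !expnMn -expnM [(D * _)%N]mulnC mulnAC.
Qed.

Definition below (V D N : nat) (a : edge_data V D N) : pred (edge_data V D N) :=
  [pred c : edge_data V D N |
     (c.1.1 == a.1.1) && [forall j, (c.1.2 j <= a.1.2 j)%N]].

Lemma edge_belowE V E D N (w : outcome V E D N) f e :
  edge_below w f e = (data_of w f \in below (data_of w e)).
Proof.
rewrite inE !ffunE /=; congr andb.
by apply: eq_forallb => j; rewrite !ffunE.
Qed.

Lemma card_ord_le n (k : 'I_n) : #|[pred i : 'I_n | (i <= k)%N]| = k.+1.
Proof.
transitivity (\sum_(i < n | (i < k.+1)%N) 1)%N; first by rewrite sum1_card.
by rewrite -(big_ord_widen n (fun=> 1%N) (ltn_ord k)) sum1_card card_ord.
Qed.

Lemma card_below V D N (a : edge_data V D N) :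
  #|below a| = (\prod_j (a.1.2 j).+1 * 2)%N.
Proof.
pose lower := [pred u : {ffun 'I_D -> 'I_N} | [forall j, (u j <= a.1.2 j)%N]].
have lowerE : #|lower| = (\prod_j (a.1.2 j).+1)%N.
  rewrite (card_ffun_forall (fun j => [pred k : 'I_N | (k <= a.1.2 j)%N])).
  by apply: eq_bigr => j _; rewrite card_ord_le.
rewrite -lowerE -card_bool -[#|lower|]mul1n -(card1 a.1.1) -!cardX.
by apply: eq_card => -[[v u] b]; rewrite !inE /= andbT.
Qed.

(** * Edges that are minimal at both ends *)

Section MinimalEdges.
Variables V D N : nat.
Hypotheses (V_gt0 : (0 < V)%N) (N_gt0 : (0 < N)%N).
Local Notation J := (edge_data V D N).

Lemma card_edge_data : #|J| = (V * N ^ D * 2)%N.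
Proof. by rewrite !card_prod card_ffun !card_ord card_bool. Qed.

Lemma card_edge_data_gt0 : 0 < #|J|%:R :> R.
Proof. by rewrite ltr0n card_edge_data !muln_gt0 V_gt0 expn_gt0 N_gt0. Qed.

Lemma Pr_below (a : J) : Pr R (below a) = volume R a.1.2 / V%:R.
Proof.
have V_neq0 : V%:R != 0 :> R by rewrite pnatr_eq0 -lt0n.
have N_neq0 : N%:R != 0 :> R by rewrite pnatr_eq0 -lt0n.
rewrite /Pr card_below card_edge_data /volume prodf_div prodr_const card_ord.
rewrite !natrM natr_prod natrX; field.
by rewrite V_neq0 expf_neq0.
Qed.

(** One-sided: [c] may lie above [a] or [b]. *)
Definition incomparable (a b : J) : pred J :=
  [pred c : J | (c \notin below a) && (c \notin below b)].

(* Bounding one factor of the square through a and the other through b separates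
   the two variables even if their down-sets overlap, as they may at a loop. *)
Lemma Pr_incomparable_sqr (a b : J) :
  Pr R (incomparable a b) ^+ 2 <=
    expR (- (volume R a.1.2 / V%:R)) * expR (- (volume R b.1.2 / V%:R)).
Proof.
have J_gt0 : (0 < #|J|)%N by rewrite -(ltr0n R) card_edge_data_gt0.
have bound (c : J) : {subset incomparable a b <= [predC below c]} ->
    Pr R (incomparable a b) <= expR (- (volume R c.1.2 / V%:R)).
  move=> /(sub_Pr R)/le_trans; apply.
  apply: le_trans (expR_ge1Dx _); rewrite -Pr_below.
  by rewrite (Pr_compl R (below c)) // opprB addrC subrK.
rewrite expr2 ler_pM ?Pr_ge0 // bound // => c; rewrite !inE => /andP[] //.
Qed.

Lemma sum_edge_data (F : {ffun 'I_D -> 'I_N} -> R) :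
  \sum_(a : J) F a.1.2 = V%:R * 2%:R * \sum_u F u.
Proof.
rewrite -(pair_bigA _ (fun vu (b : bool) => F vu.2)) /=.
rewrite -(pair_bigA _ (fun (v : 'I_V) u => \sum_(b : bool) F u)) /=.
rewrite [LHS]sumr_const card_ord -[LHS]mulr_natl -mulrA; congr (_ * _).
rewrite mulr_sumr; apply: eq_bigr => u _.
by rewrite sumr_const card_bool mulr_natl.
Qed.

(** Given the data of [i], the other [E.-1] topological edges are independent, and each must keep
    both orientations out of two down-sets; this produces the square bounded in
    [Pr_incomparable_sqr]. *)
Lemma Pr_no_edge_below (E : nat) (i : 'I_E) (s : R) : (1 < E)%N -> 0 < s < 1 ->
  Pr R (fun w : outcome V E D N => no_edge_below w i)
    <= ((E.-1%:R / V%:R) `^ (- s) * (1 - s)^-1 ^+ D) ^+ 2.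
Proof.
move=> E_gt1 s01; set m : R := E.-1%:R / V%:R.
have m_gt0 : 0 < m by rewrite divr_gt0 // ltr0n // -subn1 subn_gt0.
have J_gt0 := card_edge_data_gt0.
pose free (u : J * J) : pred (J * J) :=
  [pred z : J * J | (z.1 \in incomparable u.1 u.2) &&
                    (z.2 \in incomparable u.1 u.2)].
pose Q (y : {ffun 'I_E -> J * J}) := [forall (k | k != i), y k \in free (y i)].
apply: (@le_trans _ _ (Pr R Q)).
  apply: le_trans (Pr_edge_pairs Q).
  apply: le_trans (Pr_data_of (fun x => Q (edge_pairs x))).
  apply: sub_Pr => w /forall_inP w_i; apply/forall_inP => k ki.
  have free_k b : data_of w (k, b) \in incomparable (data_of w (i, false))
                                                    (data_of w (i, true)).
    have := w_i (k, b); rewrite !xpair_eqE (negPf ki) /= => /(_ isT).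
    by rewrite !edge_belowE.
  by rewrite [edge_pairs _ k]ffunE [edge_pairs _ i]ffunE inE /= !free_k.
have free_card u : #|free u| = (#|incomparable u.1 u.2| ^ 2)%N.
  by rewrite -mulnn -cardX; apply: eq_card => -[z1 z2]; rewrite !inE.
rewrite /Pr (card_ffun_pivot i (fun u _ => free u)).
under eq_bigr => u _ do rewrite prod_nat_const cardC1 card_ord free_card.
have -> : #|{ffun 'I_E -> J * J}|%:R =
          (#|J|%:R ^+ 2) ^+ E.-1 * #|J|%:R ^+ 2 :> R.
  rewrite card_ffun card_prod card_ord mulnn !natrX -exprSr prednK //.
  exact: ltnW.
rewrite natr_sum ler_pdivrMr; last by rewrite mulr_gt0 // !exprn_gt0.
apply: (@le_trans _ _ (\sum_(u : J * J) (#|J|%:R ^+ 2) ^+ E.-1 *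
   (expR (- (m * volume R u.1.1.2)) * expR (- (m * volume R u.2.1.2))))).
  apply: ler_sum => u _.
  have cE : #|incomparable u.1 u.2|%:R = #|J|%:R * Pr R (incomparable u.1 u.2).
    by rewrite mulrC divfK // gt_eqF.
  rewrite !natrX cE [X in X ^+ E.-1]exprMn exprMn ler_pM2l ?exprn_gt0 //.
  (* Raising to the power [E.-1] turns [1 / V] into [m]. *)
  have exp_pow c : expR (- (m * c)) = expR (- (c / V%:R)) ^+ E.-1 :> R.
    by rewrite -expRM_natl mulrN /m mulrAC mulrA.
  rewrite !exp_pow -exprMn.
  rewrite lerXn2r ?nnegrE ?mulr_ge0 ?expR_ge0 ?exprn_ge0 ?Pr_ge0 //.
  exact: Pr_incomparable_sqr.
rewrite -mulr_sumr mulrCA ler_pM2l ?exprn_gt0 //.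
(* The summand is a product of one function at each end of [i], so the double sum is a square. *)
rewrite -(pair_bigA _ (fun a b : J =>
  expR (- (m * volume R a.1.2)) * expR (- (m * volume R b.1.2)))) /=.
rewrite -big_distrlr /= -expr2 -exprMn.
have sum_ge0 : 0 <= \sum_(a : J) expR (- (m * volume R a.1.2)).
  by apply: sumr_ge0 => a _; apply: expR_ge0.
have s1_ge0 : 0 <= (1 - s)^-1.
  by rewrite invr_ge0 subr_ge0; case/andP: s01 => _ /ltW.
rewrite lerXn2r ?nnegrE ?mulr_ge0 ?powR_ge0 ?exprn_ge0 ?(ltW J_gt0) //.
rewrite (sum_edge_data (fun u => expR (- (m * volume R u)))).
rewrite card_edge_data !natrM natrX.
apply: le_trans (ler_wpM2l _ (sum_expRN_volume D N m_gt0 s01)) _.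
  by rewrite -natrM.
by rewrite exprMn le_eqVlt; apply/orP; left; apply/eqP; rewrite exprVn; ring.
Qed.
End MinimalEdges.
End RandomGraphEvents.

(** * Union bound over the failure events *)

Section Flexibility.
Variables (R : realType) (V E D N : nat) (p : 'I_D -> nat).
Hypotheses (p_prime : forall j, prime (p j)) (p_inj : injective p).
Hypotheses (V_gt0 : (0 < V)%N) (E_gt1 : (1 < E)%N) (D_gt0 : (0 < D)%N).
Hypothesis N_gt0 : (0 < N)%N.

(** Four failures are possible: an edge with no competitor below either end, an unjoined pair, two
    equal exponents of one prime, a zero exponent of [p j0]. The last two have probability of order
    [1 / N]. *)
Lemma flexible_prob_ge s : 0 < s < 1 ->
  1 - (E%:R * ((E.-1%:R / V%:R) `^ (- s) * (1 - s)^-1 ^+ D) ^+ 2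
       + V%:R ^+ 2 * expR (- (E%:R / V%:R ^+ 2)))
    - (E * 2 * (E * 2 * D) + E * 2)%:R / N%:R
  <= flexible_prob R V E N p_prime.
Proof.
move=> s01; set B1 := _ `^ _ * _; set B2 := expR _.
have ffun_gt0 (T : finType) n : (0 < n)%N -> (0 < #|{ffun T -> 'I_n}|)%N.
  by move=> n_gt0; rewrite card_ffun card_ord expn_gt0 n_gt0.
have pair_gt0 : (0 < #|{: {ffun oedge E -> 'I_V} * {ffun oedge E -> bool}}|)%N.
  by rewrite card_prod muln_gt0 ffun_gt0 // card_ffun card_bool expn_gt0.
rewrite -[flexible_prob _ _ _ _ _]/(Pr R [pred w : outcome V E D N |
  `[< flexible (random_gbs p_prime w) >]]).
rewrite Pr_compl; last by rewrite card_prod muln_gt0 pair_gt0 ffun_gt0.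
rewrite -addrA -opprD lerD2l lerN2.
pose j0 : 'I_D := Ordinal D_gt0.
pose bad_join := [pred w : outcome V E D N |
  [exists uv, ~~ joined w uv.1 uv.2]].
pose bad_zero := [pred w : outcome V E D N |
  [exists e, w.2 (e, j0) == Ordinal N_gt0]].
(* Distinctness of the edges is part of the event, so the union can run over all triples; for equal
   edges the event is empty. *)
pose coincide (k : oedge E * (oedge E * 'I_D)) (w : outcome V E D N) :=
  (k.1 != k.2.1) && (w.2 (k.1, k.2.2) == w.2 (k.2.1, k.2.2)).
pose bad_coin := [pred w : outcome V E D N | [exists k, coincide k w]].
pose bad_min := [pred w : outcome V E D N | [exists i, no_edge_below w i]].
have bad : {subset [predC [pred w : outcome V E D N |
    `[< flexible (random_gbs p_prime w) >]]] <=
    [predU [predU bad_min & bad_join] & [predU bad_coin & bad_zero]]}.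
  move=> w; rewrite !inE; apply: contraR; rewrite !negb_or -!andbA.
  case/and4P => w_min w_join w_coin w_zero; apply/asboolP.
  apply: (@flexible_random_gbs _ _ _ _ _ p_prime p_inj w j0)
    => [u v uv|e|e f j ef|i].
  - apply: contraNT w_join => uv_not.
    by apply/existsP; exists (u, v).
  - apply: contraNneq w_zero => e0.
    by apply/existsP; exists e; apply/eqP/val_inj.
  - apply: contraNN w_coin => efj.
    by apply/existsP; exists (e, (f, j)); rewrite /coincide ef.
  - by apply: contraNN w_min => w_i; apply/existsP; exists i.
apply: le_trans (sub_Pr R bad) _.
apply: le_trans (Pr_predU _ _ _) _; apply: lerD.
  apply: le_trans (Pr_predU _ _ _) _; apply: lerD.
    apply: le_trans (Pr_exists _) _; last by rewrite card_ord.
    by move=> i; apply: Pr_no_edge_below.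
  apply: le_trans (Pr_exists _) _; last first.
    by rewrite card_prod card_ord natrM -expr2.
  by move=> uv; apply: Pr_unjoined.
apply: le_trans (Pr_predU _ _ _) _; rewrite natrD mulrDl; apply: lerD.
  apply: le_trans (Pr_exists _) _; last first.
    by rewrite !card_prod !card_ord !card_bool.
  move=> [e [f j]]; have [ef|ef] := eqVneq e f.
    rewrite /Pr eq_card0 ?mul0r ?invr_ge0 // => w.
    by rewrite !inE /coincide ef eqxx.
  rewrite -[N in N%:R^-1]card_ord.
  rewrite -(@Pr_ffun_coincide R (oedge E * 'I_D)%type 'I_N (e, j) (f, j)).
  - rewrite -(Pr_snd R (fun x : {ffun oedge E * 'I_D -> 'I_N} =>
      x (e, j) == x (f, j)) pair_gt0).
    by apply: sub_Pr => w /andP[].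
  - by rewrite xpair_eqE negb_and ef.
  - by rewrite card_ord.
apply: le_trans (Pr_exists _) _; last first.
  by rewrite !card_prod !card_ord !card_bool.
move=> e; rewrite -[N in N%:R^-1]card_ord.
rewrite -(@Pr_ffun_point R (oedge E * 'I_D)%type 'I_N (e, j0) (Ordinal N_gt0)).
by rewrite -(Pr_snd R (fun x : {ffun oedge E * 'I_D -> 'I_N} =>
  x (e, j0) == Ordinal N_gt0) pair_gt0).
Qed.
End Flexibility.

Theorem theorem2 (R : realType) (eps : R) (V E D : nat) (p : 'I_D -> nat)
  (p_prime : forall j : 'I_D, prime (p j)) (p_inj : injective p)
  (eps_gt0 : 0 < eps) (eps_lt : eps < 1 / 50%:R)
  (V_gt0 : (0 < V)%N) (E_gt0 : (0 < E)%N) (D_gt0 : (0 < D)%N)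
  (hEV : V%:R `^ (2%:R + eps) <= E%:R :> R)
  (hED : expR (2%:R * D%:R / eps ^+ 2) <= E%:R :> R) :
  1 - 1 / (E%:R `^ (eps / 8%:R)) <= flexible_liminf R V E p_prime.
Proof.
have eps01 : 0 < eps < 1 / 50%:R by rewrite eps_gt0.
(* Closeness of [s] to 1 keeps the loss in the exponent of [E] of order [eps], while [hED] pays for
   the power [D] of [(1 - s)^-1 = 20 / eps]. *)
have s01 : 0 < 1 - eps / 20%:R < 1 by apply/andP; split; lra.
have [fail_le E_gt1] := failure_bound_le eps01 V_gt0 E_gt0 D_gt0 hEV hED.
(* The constant counts possible coincidences and zero exponents; only this part of the bound depends
   on [N]. *)
apply: (@le_limn_inf_div _ _ _ (E * 2 * (E * 2 * D) + E * 2)%:R)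
  => // [N|N N_gt0].
  by rewrite (Pr_ge0 R) (Pr_le1 R).
apply: le_trans (flexible_prob_ge p_prime p_inj V_gt0 E_gt1 D_gt0 N_gt0 s01).
by rewrite lerD2r lerD2l lerN2.
Qed.
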